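(* There exists a constant $C>0$ such that the following holds. Let $f:\mathbb{R}\to\mathbb{R}$ be a globally continuous function with a bounded second derivative on $\mathbb{R}\setminus\{z\}$ and a discontinuity (jump) in the first derivative at a point $z$. Then for all $h>0$ the adapted ENO-SR interpolant $\mathcal{I}^hf$ (on a uniform grid of mesh width $h$) satisfies $$\|f-\mathcal{I}^hf\|_\infty\le C\,h^2\sup_{\mathbb{R}\setminus\{z\}}|f''| ,$$ with $C$ independent of $f$ (and of $h$).
   Context: **Grid.** For $h>0$ consider a uniform grid $x_i=x_0+ih$, $i\in\mathbb{Z}$, and $I_i=[x_{i-1},x_i]$. Let $\Delta^2_hf(x)=f(x-h)-2f(x)+f(x+h)$, and let $p_i$ be the affine function on $\mathbb{R}$ interpolating $f$ at the two endpoints of $I_i$. **Adapted ENO-SR detection.** Each interval is labelled $B$ (bad) or $G$ (good) by: 1. $I_{i-1}$ and $I_i$ are labelled $B$ if $|\Delta^2_hf(x_{i-1})|>\max_{n=1,2,3}|\Delta^2_hf(x_{i-1\pm n})|$ (maximum over both signs). 2. $I_i$ is labelled $B$ if $|\Delta^2_hf(x_i)|>\max_{n=1,2}|\Delta^2_hf(x_{i+n})|$ and $|\Delta^2_hf(x_{i-1})|>\max_{n=1,2}|\Delta^2_hf(x_{i-1-n})|$. 3. All other intervals are labelled $G$. **Adapted ENO-SR interpolation.** If $I_i$ is labelled $G$, set $\mathcal{I}^h_if=p_i$. If $I_i$ is labelled $B$ and the graphs of $p_{i-2}$ and $p_{i+2}$ intersect in exactly one point, with abscissa $y\in\mathbb{R}$,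 set $\mathcal{I}^h_if(x)=p_{i-2}(x)$ for $x<y$ and $\mathcal{I}^h_if(x)=p_{i+2}(x)$ for $x\ge y$. If $I_i$ is labelled $B$ but there is no single intersection point, set $\mathcal{I}^h_if=p_i$. The interpolant $\mathcal{I}^hf$ is the function equal to $\mathcal{I}^h_if$ on $[x_{i-1},x_i)$ for every $i$. *)

(* Defs.v *)
From Stdlib Require Import Reals RList ZArith List Lra Lia ClassicalEpsilon.
From Coquelicot Require Import Coquelicot.
Import ListNotations.
Open Scope R_scope.

Definition grid (x0 h : R) (i : Z) : R := x0 + IZR i * h.

Definition Delta2 (h : R) (f : R -> R) (x : R) : R :=
  f (x - h) - 2 * f x + f (x + h).

(* The affine interpolant on the interval I_i = [x_(i-1), x_i]; it is a
   function on the whole line. *)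
Definition affine_interp (f : R -> R) (x0 h : R) (i : Z) (x : R) : R :=
  let a := grid x0 h (i - 1) in
  let b := grid x0 h i in
  f a + (f b - f a) / (b - a) * (x - a).

Definition absD2 (f : R -> R) (x0 h : R) (i : Z) : R :=
  Rabs (Delta2 h f (grid x0 h i)).

(* |D2 f(x_j)| strictly exceeds its values at the nodes x_(j+n), n in ns. *)
Definition dominates (f : R -> R) (x0 h : R) (j : Z) (ns : list Z) : Prop :=
  absD2 f x0 h j > MaxRlist (map (fun n => absD2 f x0 h (j + n)%Z) ns).

Definition isolated_peak (f : R -> R) (x0 h : R) (j : Z) : Prop :=
  dominates f x0 h j [1; 2; 3; -1; -2; -3]%Z.

(* A peak at x_j marks the two intervals I_j and I_(j+1) meeting at x_j, so
   I_i is marked by a peak at either of its endpoints x_(i-1), x_i. *)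
Definition bad (f : R -> R) (x0 h : R) (i : Z) : Prop :=
  isolated_peak f x0 h (i - 1) \/
  isolated_peak f x0 h i \/
  (dominates f x0 h i [1; 2]%Z /\ dominates f x0 h (i - 1) [-1; -2]%Z).

Definition enosr_local (f : R -> R) (x0 h : R) (i : Z) (x : R) : R :=
  let p := affine_interp f x0 h in
  if excluded_middle_informative (bad f x0 h i) then
    match excluded_middle_informative
            (exists! y, p (i - 2)%Z y = p (i + 2)%Z y) with
    | left H =>
        let y := proj1_sig (constructive_definite_description _ H) in
        if Rlt_dec x y then p (i - 2)%Z x else p (i + 2)%Z x
    | right _ => p i x
    end
  else p i x.

(* The index i with x in [x_(i-1), x_i) is floor ((x - x0) / h) + 1; see
   enosr_spec. *)
Definition enosr (f : R -> R) (x0 h : R) (x : R) : R :=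
  enosr_local f x0 h (Int_part ((x - x0) / h) + 1) x.

Lemma enosr_spec (f : R -> R) (x0 h : R) (hpos : 0 < h) (i : Z) (x : R) :
  grid x0 h (i - 1) <= x < grid x0 h i ->
  enosr f x0 h x = enosr_local f x0 h i x.
Proof.
intros [H1 H2]; unfold enosr, grid in *.
replace (Int_part ((x - x0) / h) + 1)%Z with i; [reflexivity|].
assert (Hx : x - x0 = (x - x0) / h * h) by (field; lra).
enough (i - 1 = Int_part ((x - x0) / h))%Z by lia.
apply Int_part_spec; split.
- apply Rplus_lt_reg_r with 1.
  apply Rmult_lt_reg_r with h; [lra|].
  rewrite minus_IZR in *; lra.
- apply Rmult_le_reg_r with h; [lra|]; lra.
Qed.

(* sup over A of |g|, as an extended real. *)
Definition sup_abs (A : R -> Prop) (g : R -> R) : Rbar :=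
  Lub_Rbar (fun y => exists x, A x /\ y = Rabs (g x)).

Definition sup_norm (g : R -> R) : Rbar := sup_abs (fun _ => True) g.

(* The one-sided limits of f' at z exist and differ. *)
Definition derivative_jump (f : R -> R) (z : R) : Prop :=
  exists l r : R,
    filterlim (Derive f) (at_left z) (locally l) /\
    filterlim (Derive f) (at_right z) (locally r) /\
    l <> r.

Definition bounded_second_derivative_off (f : R -> R) (z : R) : Prop :=
  (* ex_derive_n f 2 x alone only says that the total function Derive f is
     differentiable at x. *)
  (forall x, x <> z -> ex_derive f x /\ ex_derive_n f 2 x) /\
  (exists M : R, forall x, x <> z -> Rabs (Derive_n f 2 x) <= M).

(* Main.v *)
(* With J the jump of f' at z, f = g + J max(0, x - z) where g' is Lipschitz with
   constant M = sup |f''|. Put E = M h^2; every secant of g has error O(E) at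
   distance O(h), and second differences of g are O(E). Let I_k contain z.
   If |J| h = O(E), any interpolant involved has error O(|J| h + E) = O(E).
   Otherwise one of x_(k-1), x_k carries a second difference far above the noise,
   so I_(k-2) and I_(k+2), whose stencils would touch I_k, are never bad; I_k
   fails to be bad only when z is so close to a node that p_k is accurate anyway;
   and for a bad I_(k-1), I_k or I_(k+1) the two affine functions follow the two
   smooth branches up to O(E). Their difference is J (x - z) + O(E) and changes
   sign exactly at the crossing y, so J (x - z) = O(E) wherever x lies between
   z and y. *)
Require Import Defs.
From Stdlib Require Import Reals RList ZArith List Lra Lia ClassicalEpsilon.
From Coquelicot Require Import Coquelicot.
Open Scope R_scope.

(** * Secants and second differences under a Taylor bound *)

Definition secant (f : R -> R) (a h x : R) : R :=
  f a + (f (a + h) - f a) / h * (x - a).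

Definition kink (z J x : R) : R := J * Rmax 0 (x - z).

(** The estimates below see the smooth part of [f] only through this first-order remainder bound.
    The slope [g'] is an arbitrary function, so that its value at [z] can be prescribed by hand. *)
Definition taylor_bound (g : R -> R) (M : R) : Prop :=
  exists g' : R -> R,
    forall x y, Rabs (g y - g x - g' x * (y - x)) <= M * (y - x) ^ 2.

Lemma Rabs_le_of (x b : R) : - b <= x -> x <= b -> Rabs x <= b.
Proof. intros; apply Rabs_le; lra. Qed.

(** The error combines two Taylor remainders at [a]: the one at [a + h], weighted by [(x - a) / h]
    of size at most 3, and the one at [x]. They contribute 3 and 9 times [M * h ^ 2]. The radius
    [3 * h] is how far a point of I_i can be from the left end of I_(i-2). *)
Lemma secant_taylor (g : R -> R) (M a h x : R) :
  0 < h -> 0 <= M -> taylor_bound g M -> Rabs (x - a) <= 3 * h ->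
  Rabs (secant g a h x - g x) <= 12 * (M * h ^ 2).
Proof.
intros Hh HM [g' Hg] Hx.
assert (H1 := Hg a (a + h)); assert (H2 := Hg a x).
unfold secant.
replace (g a + (g (a + h) - g a) / h * (x - a) - g x) with
  ((g (a + h) - g a - g' a * (a + h - a)) * ((x - a) / h)
   - (g x - g a - g' a * (x - a))) by (field; lra).
assert (Hq : Rabs ((x - a) / h) <= 3).
{ unfold Rdiv; rewrite Rabs_mult, Rabs_inv, (Rabs_pos_eq h) by lra.
  apply Rmult_le_reg_r with h; [lra|].
  rewrite Rmult_assoc, Rinv_l by lra; lra. }
assert (Hs : (x - a) ^ 2 <= 9 * h ^ 2).
{ rewrite <- (pow2_abs (x - a)); assert (0 <= Rabs (x - a)) by apply Rabs_pos; nra. }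
replace (a + h - a) with h in * by ring.
eapply Rle_trans; [apply Rabs_triang|].
rewrite Rabs_Ropp, Rabs_mult.
assert (Rabs (g (a + h) - g a - g' a * h) * Rabs ((x - a) / h) <= M * h ^ 2 * 3)
  by (apply Rmult_le_compat; auto using Rabs_pos).
assert (M * (x - a) ^ 2 <= M * (9 * h ^ 2)) by (apply Rmult_le_compat_l; lra).
lra.
Qed.

Lemma Delta2_taylor (g : R -> R) (M h x : R) :
  taylor_bound g M -> Rabs (Delta2 h g x) <= 2 * (M * h ^ 2).
Proof.
intros [g' Hg]; unfold Delta2.
assert (H1 := Hg x (x + h)); assert (H2 := Hg x (x - h)).
replace (x + h - x) with h in H1 by ring.
replace (x - h - x) with (- h) in H2 by ring.
replace (g (x - h) - 2 * g x + g (x + h)) with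
  (g (x + h) - g x - g' x * h + (g (x - h) - g x - g' x * - h)) by ring.
eapply Rle_trans; [apply Rabs_triang|].
replace ((- h) ^ 2) with (h ^ 2) in H2 by ring; lra.
Qed.

(** * Secants of the kink *)

Lemma kink_left (z J x : R) : x <= z -> kink z J x = 0.
Proof. intros; unfold kink; rewrite Rmax_left by lra; ring. Qed.

Lemma kink_right (z J x : R) : z <= x -> kink z J x = J * (x - z).
Proof. intros; unfold kink; rewrite Rmax_right by lra; ring. Qed.

Lemma secant_kink_left (z J a h x : R) :
  0 < h -> a + h <= z -> secant (kink z J) a h x = 0.
Proof.
intros; unfold secant; rewrite !kink_left by lra; unfold Rdiv; ring.
Qed.

Lemma secant_kink_right (z J a h x : R) :
  0 < h -> z <= a -> secant (kink z J) a h x = J * (x - z).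
Proof.
intros; unfold secant; rewrite !kink_right by lra; field; lra.
Qed.

Lemma kink_lipschitz (z J x y : R) :
  Rabs (kink z J x - kink z J y) <= Rabs J * Rabs (x - y).
Proof.
unfold kink; rewrite <- Rmult_minus_distr_l, Rabs_mult.
apply Rmult_le_compat_l; [apply Rabs_pos|].
unfold Rmax; destruct (Rle_dec 0 (x - z)), (Rle_dec 0 (y - z));
  unfold Rabs; repeat destruct Rcase_abs; lra.
Qed.

(** Both the value and the secant slope are controlled by the Lipschitz constant [Rabs J]; over a
    distance [3 * h] each costs [3 * (Rabs J * h)]. *)
Lemma secant_kink_coarse (z J a h x : R) :
  0 < h -> Rabs (x - a) <= 3 * h ->
  Rabs (secant (kink z J) a h x - kink z J x) <= 6 * (Rabs J * h).
Proof.
intros Hh Hx; unfold secant.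
assert (HJ := Rabs_pos J).
assert (H1 := kink_lipschitz z J (a + h) a).
assert (H2 := kink_lipschitz z J a x).
rewrite Rabs_minus_sym in Hx.
replace (a + h - a) with h in H1 by ring.
rewrite (Rabs_pos_eq h) in H1 by lra.
replace (kink z J a + (kink z J (a + h) - kink z J a) / h * (x - a) - kink z J x)
  with (kink z J a - kink z J x
        + (kink z J (a + h) - kink z J a) * ((x - a) / h)) by (field; lra).
eapply Rle_trans; [apply Rabs_triang|].
rewrite Rabs_mult.
assert (Hq : Rabs ((x - a) / h) <= 3).
{ unfold Rdiv; rewrite Rabs_mult, Rabs_inv, (Rabs_pos_eq h), Rabs_minus_sym by lra.
  apply Rmult_le_reg_r with h; [lra|].
  rewrite Rmult_assoc, Rinv_l by lra; lra. }
assert (Rabs (kink z J (a + h) - kink z J a) * Rabs ((x - a) / h)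
        <= Rabs J * h * 3)
  by (apply Rmult_le_compat; auto using Rabs_pos).
assert (Rabs J * Rabs (a - x) <= Rabs J * (3 * h))
  by (apply Rmult_le_compat_l; lra).
lra.
Qed.

(** Inside the cell the error peaks at [x = z], with size |J| (z - a) (a + h - z) / h. It is
    therefore small whenever [z] is close to either endpoint. *)
Lemma secant_kink_fine (z J a h x : R) :
  0 < h -> a <= z <= a + h -> a <= x <= a + h ->
  Rabs (secant (kink z J) a h x - kink z J x)
    <= Rabs J * Rmin (z - a) (a + h - z).
Proof.
intros Hh Hz Hx; unfold secant.
rewrite (kink_left z J a), (kink_right z J (a + h)) by lra.
unfold kink.
replace (0 + (J * (a + h - z) - 0) / h * (x - a) - J * Rmax 0 (x - z))
  with (J * ((a + h - z) * ((x - a) / h) - Rmax 0 (x - z))) by (field; lra).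
rewrite Rabs_mult.
apply Rmult_le_compat_l; [apply Rabs_pos|].
set (q := (x - a) / h).
assert (Hq : x = a + q * h) by (unfold q; field; lra).
assert (0 <= q <= 1) by (split; nra).
apply Rabs_le_of; unfold Rmin, Rmax;
  destruct (Rle_dec (z - a) (a + h - z)), (Rle_dec 0 (x - z)); nra.
Qed.

(** * Removing the kink from f leaves a Taylor bound *)

Lemma continuity_pt_of_continuous (f : R -> R) (x : R) :
  continuous f x -> continuity_pt f x.
Proof. intros; now apply continuity_pt_filterlim. Qed.

Lemma derive_lipschitz (f : R -> R) (M a b : R) :
  (forall x, Rmin a b <= x <= Rmax a b ->
     ex_derive_n f 2 x /\ Rabs (Derive_n f 2 x) <= M) ->
  Rabs (Derive f b - Derive f a) <= M * Rabs (b - a).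
Proof.
intros H.
assert (D : forall x, Rmin a b <= x <= Rmax a b ->
              is_derive (Derive f) x (Derive_n f 2 x)).
{ intros x Hx; apply (Derive_correct (Derive f)), (H x Hx). }
destruct (MVT_gen (Derive f) a b (Derive_n f 2)) as [c [Hc Hd]].
- intros x Hx; apply D; lra.
- intros x Hx; apply continuity_pt_of_continuous.
  apply (ex_derive_continuous (Derive f)).
  now exists (Derive_n f 2 x); apply D.
- rewrite Hd, Rabs_mult.
  apply Rmult_le_compat_r; [apply Rabs_pos|]; now apply H.
Qed.

Lemma lipschitz_at_left (u : R -> R) (M x z l : R) :
  x < z -> 0 <= M ->
  (forall w, x < w < z -> Rabs (u w - u x) <= M * Rabs (w - x)) ->
  filterlim u (at_left z) (locally l) ->
  Rabs (l - u x) <= M * Rabs (z - x).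
Proof.
intros Hx HM Hu Hl; apply Rle_plus_epsilon;  intros eps He.
destruct (Hl (fun y => Rabs (y - l) < eps)) as [d Hd].
{ exists (mkposreal eps He); intros y Hy; exact Hy. }
assert (Hd0 := cond_pos d).
(* A point strictly between [x] and [z] that is also within [d] of [z]. *)
set (w := Rmax ((x + z) / 2) (z - d / 2)).
assert (x < w < z /\ z - d < w) as [Hw Hw'].
{ unfold w, Rmax; destruct Rle_dec; lra. }
specialize (Hd w); cbv beta in Hd.
assert (Hb : ball z d w).
{ change (Rabs (w - z) < d); rewrite Rabs_left; lra. }
specialize (Hd Hb (proj2 Hw)).
specialize (Hu w Hw).
assert (M * Rabs (w - x) <= M * Rabs (z - x)).
{ apply Rmult_le_compat_l; [lra|]; rewrite !Rabs_pos_eq; lra. }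
replace (l - u x) with (u w - u x - (u w - l)) by ring.
eapply Rle_trans; [apply Rabs_triang|]; rewrite Rabs_Ropp; lra.
Qed.

Lemma lipschitz_at_right (u : R -> R) (M x z r : R) :
  z < x -> 0 <= M ->
  (forall w, z < w < x -> Rabs (u w - u x) <= M * Rabs (w - x)) ->
  filterlim u (at_right z) (locally r) ->
  Rabs (r - u x) <= M * Rabs (z - x).
Proof.
intros Hx HM Hu Hr; apply Rle_plus_epsilon;  intros eps He.
destruct (Hr (fun y => Rabs (y - r) < eps)) as [d Hd].
{ exists (mkposreal eps He); intros y Hy; exact Hy. }
assert (Hd0 := cond_pos d).
set (w := Rmin ((x + z) / 2) (z + d / 2)).
assert (z < w < x /\ w < z + d) as [Hw Hw'].
{ unfold w, Rmin; destruct Rle_dec; lra. }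
specialize (Hd w); cbv beta in Hd.
assert (Hb : ball z d w).
{ change (Rabs (w - z) < d); rewrite Rabs_pos_eq; lra. }
specialize (Hd Hb (proj1 Hw)).
specialize (Hu w Hw).
assert (M * Rabs (w - x) <= M * Rabs (z - x)).
{ apply Rmult_le_compat_l; [lra|]; rewrite !Rabs_left; lra. }
replace (r - u x) with (u w - u x - (u w - r)) by ring.
eapply Rle_trans; [apply Rabs_triang|]; rewrite Rabs_Ropp; lra.
Qed.

(** Subtracting a kink of size [r - l] makes the one-sided limits of the derivative agree at [z], so
    the glued derivative is Lipschitz across [z]; the mean value theorem then yields the
    remainder. *)
Lemma taylor_bound_minus_kink (f : R -> R) (z l r M : R) :
  0 <= M ->
  (forall x, continuous f x) ->
  (forall x, x <> z -> ex_derive f x) ->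
  (forall x, x <> z -> ex_derive_n f 2 x /\ Rabs (Derive_n f 2 x) <= M) ->
  filterlim (Derive f) (at_left z) (locally l) ->
  filterlim (Derive f) (at_right z) (locally r) ->
  taylor_bound (fun x => f x - kink z (r - l) x) M.
Proof.
intros HM Hc Hd Hd2 Hl Hr.
set (g := fun x => f x - kink z (r - l) x).
(* At [z] the total function [Derive f] carries no information, so the common limit [l] is put
   there. *)
set (g' := fun x => if Rlt_dec x z then Derive f x
                    else if Rlt_dec z x then Derive f x - (r - l) else l).
assert (gl : forall x, x < z -> g' x = Derive f x).
{ intros x Hx; unfold g'; destruct Rlt_dec; [easy|lra]. }
assert (gr : forall x, z < x -> g' x = Derive f x - (r - l)).
{ intros x Hx; unfold g'; destruct Rlt_dec; [lra|]; destruct Rlt_dec; [easy|lra]. }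
assert (gz : g' z = l).
{ unfold g'; destruct Rlt_dec; [lra|easy]. }
assert (Lf : forall x y, x < z /\ y < z \/ z < x /\ z < y ->
               Rabs (Derive f y - Derive f x) <= M * Rabs (y - x)).
{ intros x y Hxy; apply derive_lipschitz; intros t Ht; apply Hd2.
  unfold Rmin, Rmax in Ht; destruct Rle_dec; lra. }
assert (Lz : forall x, Rabs (g' z - g' x) <= M * Rabs (z - x)).
{ intros x; rewrite gz.
  destruct (Rtotal_order x z) as [Hx | [-> | Hx]].
  - rewrite gl by lra; apply lipschitz_at_left; auto; intros; apply Lf; lra.
  - rewrite gz, Rminus_diag, Rminus_diag, Rabs_R0; lra.
  - rewrite gr by lra.
    replace (l - (Derive f x - (r - l))) with (r - Derive f x) by ring.
    apply lipschitz_at_right; auto; intros; apply Lf; lra. }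
assert (Lz' : forall x, Rabs (g' x - g' z) <= M * Rabs (x - z)).
{ intros x; rewrite Rabs_minus_sym, (Rabs_minus_sym x); apply Lz. }
assert (L : forall x y, Rabs (g' y - g' x) <= M * Rabs (y - x)).
(* When [z] separates the points, the two Lipschitz estimates through [z] add up exactly, because
   the distances do. *)
{ assert (Lsplit : forall x y, x <= z <= y \/ y <= z <= x ->
            Rabs (g' y - g' x) <= M * Rabs (y - x)).
  { intros x y Hxy.
    replace (g' y - g' x) with (g' y - g' z + (g' z - g' x)) by ring.
    eapply Rle_trans; [apply Rabs_triang|].
    replace (Rabs (y - x)) with (Rabs (y - z) + Rabs (z - x)).
    - assert (H1 := Lz' y); assert (H2 := Lz x); lra.
    - unfold Rabs; repeat destruct Rcase_abs; lra. }
  intros x y.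
  destruct (Rlt_dec x z), (Rlt_dec y z).
  - rewrite !gl by lra; apply Lf; lra.
  - apply Lsplit; lra.
  - apply Lsplit; lra.
  - destruct (Rlt_dec z x), (Rlt_dec z y); try (apply Lsplit; lra).
    rewrite !gr by lra.
    replace (Derive f y - (r - l) - (Derive f x - (r - l)))
      with (Derive f y - Derive f x) by ring.
    apply Lf; lra. }
(* [MVT_gen] asks for a derivative only in the open interval, so [z] may be an endpoint. On the
   right, [f] has derivative [g' + (r - l)], and the extra slope is that of the kink. *)
assert (MV : forall a b, a <= z /\ b <= z \/ z <= a /\ z <= b ->
    exists c, Rmin a b <= c <= Rmax a b /\ g b - g a = g' c * (b - a)).
{ intros a b [Hab | Hab].
  - destruct (MVT_gen f a b g') as [c [Hc1 Hc2]].
    + intros x Hx.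
      assert (x < z) by (unfold Rmin, Rmax in Hx; destruct Rle_dec; lra).
      rewrite gl by lra; apply Derive_correct, Hd; lra.
    + intros x _; now apply continuity_pt_of_continuous.
    + exists c; split; [exact Hc1|].
      unfold g; rewrite !kink_left by lra; lra.
  - destruct (MVT_gen f a b (fun x => g' x + (r - l))) as [c [Hc1 Hc2]].
    + intros x Hx.
      assert (z < x) by (unfold Rmin, Rmax in Hx; destruct Rle_dec; lra).
      rewrite gr by lra.
      replace (Derive f x - (r - l) + (r - l)) with (Derive f x) by ring.
      apply Derive_correct, Hd; lra.
    + intros x _; now apply continuity_pt_of_continuous.
    + exists c; split; [exact Hc1|].
      unfold g; rewrite !kink_right by lra; lra. }
(* The base point [x] of the slope is kept apart from the segment from [a] to [b], so that a path
   crossing [z] can be cut there while both pieces use the same slope [g' x]. *)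
assert (T : forall x a b, a <= z /\ b <= z \/ z <= a /\ z <= b ->
    forall D, Rabs (a - x) <= D -> Rabs (b - x) <= D ->
    Rabs (g b - g a - g' x * (b - a)) <= M * D * Rabs (b - a)).
{ intros x a b Hab D Ha Hb.
  destruct (MV a b Hab) as [c [Hc1 ->]].
  rewrite <- Rmult_minus_distr_r, Rabs_mult.
  apply Rmult_le_compat_r; [apply Rabs_pos|].
  eapply Rle_trans; [apply L|]; apply Rmult_le_compat_l; [lra|].
  revert Hc1 Ha Hb; unfold Rabs, Rmin, Rmax; destruct Rle_dec;
    repeat destruct Rcase_abs; lra. }
exists g'; intros x y; fold (g x) (g y).
assert (H0 : Rabs (x - x) <= Rabs (y - x))
  by (rewrite Rminus_diag, Rabs_R0; apply Rabs_pos).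
assert (E : M * (y - x) ^ 2 = M * Rabs (y - x) * Rabs (y - x))
  by (rewrite <- (pow2_abs (y - x)); ring).
rewrite E.
(* In the two remaining cases [z] lies between [x] and [y]. Both pieces use [T] with [D] equal to
   [Rabs (y - x)], and their lengths sum to that distance. *)
destruct (Rle_dec x z), (Rle_dec y z); try (apply T; lra).
- assert (Hz : Rabs (z - x) <= Rabs (y - x)) by (rewrite !Rabs_pos_eq; lra).
  assert (H1 := T x x z ltac:(lra) _ H0 Hz).
  assert (H2 := T x z y ltac:(lra) _ Hz (Rle_refl _)).
  replace (g y - g x - g' x * (y - x)) with
    (g z - g x - g' x * (z - x) + (g y - g z - g' x * (y - z))) by ring.
  eapply Rle_trans; [apply Rabs_triang|].
  replace (Rabs (y - x)) with (Rabs (z - x) + Rabs (y - z)) at 2; [lra|].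
  rewrite !Rabs_pos_eq; lra.
- assert (Hz : Rabs (z - x) <= Rabs (y - x)) by (rewrite !Rabs_left1; lra).
  assert (H1 := T x x z ltac:(lra) _ H0 Hz).
  assert (H2 := T x z y ltac:(lra) _ Hz (Rle_refl _)).
  replace (g y - g x - g' x * (y - x)) with
    (g z - g x - g' x * (z - x) + (g y - g z - g' x * (y - z))) by ring.
  eapply Rle_trans; [apply Rabs_triang|].
  replace (Rabs (y - x)) with (Rabs (z - x) + Rabs (y - z)) at 2; [lra|].
  rewrite !Rabs_left1; lra.
Qed.

(** * Secants and second differences of f, by linearity *)

Lemma secant_split (f k : R -> R) (a h x : R) :
  h <> 0 ->
  secant f a h x = secant (fun t => f t - k t) a h x + secant k a h x.
Proof. intros; unfold secant; field; assumption. Qed.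

Lemma secant_coarse (f : R -> R) (z J M a h x : R) :
  0 < h -> 0 <= M -> taylor_bound (fun t => f t - kink z J t) M ->
  Rabs (x - a) <= 3 * h ->
  Rabs (secant f a h x - f x) <= 6 * (Rabs J * h) + 12 * (M * h ^ 2).
Proof.
intros Hh HM Hf Hx.
assert (H1 := secant_taylor _ _ _ _ _ Hh HM Hf Hx).
assert (H2 := secant_kink_coarse z J a h x Hh Hx).
rewrite (secant_split f (kink z J)) by lra.
apply Rabs_le_between in H1, H2; apply Rabs_le_of; lra.
Qed.

Lemma secant_fine (f : R -> R) (z J M a h x : R) :
  0 < h -> 0 <= M -> taylor_bound (fun t => f t - kink z J t) M ->
  a <= z <= a + h -> a <= x <= a + h ->
  Rabs (secant f a h x - f x)
    <= Rabs J * Rmin (z - a) (a + h - z) + 12 * (M * h ^ 2).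
Proof.
intros Hh HM Hf Hz Hx.
assert (Hx' : Rabs (x - a) <= 3 * h) by (rewrite Rabs_pos_eq; lra).
assert (H1 := secant_taylor _ _ _ _ _ Hh HM Hf Hx').
assert (H2 := secant_kink_fine z J a h x Hh Hz Hx).
rewrite (secant_split f (kink z J)) by lra.
apply Rabs_le_between in H1, H2; apply Rabs_le_of; lra.
Qed.

Lemma secant_left (f : R -> R) (z J M a h x : R) :
  0 < h -> 0 <= M -> taylor_bound (fun t => f t - kink z J t) M ->
  a + h <= z -> Rabs (x - a) <= 3 * h ->
  Rabs (secant f a h x - (f x - kink z J x)) <= 12 * (M * h ^ 2).
Proof.
intros Hh HM Hf Ha Hx.
rewrite (secant_split f (kink z J)), secant_kink_left, Rplus_0_r by lra.
now apply (secant_taylor (fun t => f t - kink z J t)).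
Qed.

Lemma secant_right (f : R -> R) (z J M a h x : R) :
  0 < h -> 0 <= M -> taylor_bound (fun t => f t - kink z J t) M ->
  z <= a -> Rabs (x - a) <= 3 * h ->
  Rabs (secant f a h x - (f x - kink z J x + J * (x - z))) <= 12 * (M * h ^ 2).
Proof.
intros Hh HM Hf Ha Hx.
rewrite (secant_split f (kink z J)), (secant_kink_right z J a) by lra.
assert (H1 := secant_taylor _ _ _ _ _ Hh HM Hf Hx).
apply Rabs_le_between in H1; apply Rabs_le_of; lra.
Qed.

Lemma Delta2_split (f k : R -> R) (h x : R) :
  Delta2 h f x = Delta2 h (fun t => f t - k t) x + Delta2 h k x.
Proof. unfold Delta2; ring. Qed.

Lemma Delta2_away (f : R -> R) (z J M h x : R) :
  0 < h -> taylor_bound (fun t => f t - kink z J t) M ->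
  z <= x - h \/ x + h <= z ->
  Rabs (Delta2 h f x) <= 2 * (M * h ^ 2).
Proof.
intros Hh Hf Hx.
rewrite (Delta2_split f (kink z J)).
replace (Delta2 h (kink z J) x) with 0; [rewrite Rplus_0_r; now apply Delta2_taylor|].
unfold Delta2; destruct Hx.
- rewrite !kink_right by lra; ring.
- rewrite !kink_left by lra; ring.
Qed.

(** As a function of [x], the second difference of the kink is the hat J (h - |x - z|); the smooth
    part perturbs it by at most [2 * (M * h ^ 2)]. *)
Lemma Delta2_near (f : R -> R) (z J M h x : R) :
  0 < h -> taylor_bound (fun t => f t - kink z J t) M ->
  x - h <= z <= x + h ->
  Rabs J * (h - Rabs (x - z)) - 2 * (M * h ^ 2) <= Rabs (Delta2 h f x).
Proof.
intros Hh Hf Hx.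
rewrite (Delta2_split f (kink z J)).
assert (H1 := Delta2_taylor _ M h x Hf).
replace (Delta2 h (kink z J) x) with (J * (h - Rabs (x - z))).
- assert (H2 := Rabs_triang_inv (J * (h - Rabs (x - z)))
     (- Delta2 h (fun t => f t - kink z J t) x)).
  rewrite Rabs_Ropp, Rabs_mult in H2.
  rewrite (Rabs_pos_eq (h - _)) in H2 by (unfold Rabs; destruct Rcase_abs; lra).
  rewrite Rplus_comm.
  replace (J * (h - Rabs (x - z)) + Delta2 h (fun t => f t - kink z J t) x)
    with (J * (h - Rabs (x - z)) - - Delta2 h (fun t => f t - kink z J t) x)
    by ring.
  lra.
- unfold Delta2; rewrite (kink_left z J (x - h)), (kink_right z J (x + h)) by lra.
  destruct (Rle_dec x z).
  + rewrite kink_left, Rabs_left1 by lra; ring.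
  + rewrite kink_right, Rabs_pos_eq by lra; ring.
Qed.

(** * Grid nodes and the detection of the kink *)

Lemma grid_add (x0 h : R) (i n : Z) :
  grid x0 h (i + n) = grid x0 h i + IZR n * h.
Proof. unfold grid; rewrite plus_IZR; ring. Qed.

Lemma grid_sub (x0 h : R) (i n : Z) :
  grid x0 h (i - n) = grid x0 h i - IZR n * h.
Proof. unfold grid; rewrite minus_IZR; ring. Qed.

Lemma grid_le (x0 h : R) (i j : Z) :
  0 < h -> (i <= j)%Z -> grid x0 h i <= grid x0 h j.
Proof. intros Hh H; apply IZR_le in H; unfold grid; nra. Qed.

Lemma affine_interp_secant (f : R -> R) (x0 h : R) (i : Z) (x : R) :
  affine_interp f x0 h i x = secant f (grid x0 h i - h) h x.
Proof.
unfold affine_interp, secant; rewrite grid_sub.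
replace (grid x0 h i - 1 * h) with (grid x0 h i - h) by ring.
replace (grid x0 h i - (grid x0 h i - h)) with h by ring.
now replace (grid x0 h i - h + h) with (grid x0 h i) by ring.
Qed.

Lemma grid_cell (x0 h : R) (x : R) :
  0 < h -> exists i, grid x0 h (i - 1) <= x < grid x0 h i.
Proof.
intros Hh; exists (Int_part ((x - x0) / h) + 1)%Z.
destruct (base_Int_part ((x - x0) / h)) as [H1 H2].
assert (Hx : x - x0 = (x - x0) / h * h) by (field; lra).
unfold grid; rewrite minus_IZR, plus_IZR; simpl; split; nra.
Qed.

Lemma dominates_lt (f : R -> R) (x0 h : R) (j n : Z) (ns : list Z) :
  dominates f x0 h j ns -> In n ns ->
  absD2 f x0 h (j + n) < absD2 f x0 h j.
Proof.
intros Hd Hn; eapply Rle_lt_trans; [|exact Hd].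
apply MaxRlist_P1, (in_map (fun n => absD2 f x0 h (j + n)%Z)), Hn.
Qed.

(** On a nonempty list the maximum is attained by an entry. On the empty list [MaxRlist] is 0, and
    the pointwise condition would say nothing. *)
Lemma dominates_of_lt (f : R -> R) (x0 h : R) (j : Z) (ns : list Z) :
  ns <> nil ->
  (forall n, In n ns -> absD2 f x0 h (j + n) < absD2 f x0 h j) ->
  dominates f x0 h j ns.
Proof.
intros Hns H; unfold dominates.
destruct (proj1 (in_map_iff (fun n => absD2 f x0 h (j + n)%Z) ns _)
            (MaxRlist_P2 (map (fun n => absD2 f x0 h (j + n)%Z) ns)
              ltac:(destruct ns as [|n ns]; [easy|];
                    exists (absD2 f x0 h (j + n)); now left)))
  as [n [<- Hn]].
now apply H.
Qed.

(** Whichever rule marks an interval two cells away from I_k, some node outside I_k wins a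
    comparison whose stencil covers both ends of I_k. For the two-sided rule, it is the half facing
    I_k that does so. *)
Lemma bad_dominated (f : R -> R) (x0 h : R) (i k : Z) :
  (i = k - 2 \/ i = k + 2)%Z -> bad f x0 h i ->
  exists j, (j < k - 1 \/ k < j)%Z /\
    absD2 f x0 h (k - 1) < absD2 f x0 h j /\ absD2 f x0 h k < absD2 f x0 h j.
Proof.
intros Hi Hb.
assert (E : forall ns j m, dominates f x0 h j ns -> In (m - j)%Z ns ->
              absD2 f x0 h m < absD2 f x0 h j).
{ intros ns j m Hd Hn; replace m with (j + (m - j))%Z by lia.
  now apply dominates_lt with ns. }
destruct Hb as [Hb | [Hb | [Hb1 Hb2]]].
- exists (i - 1)%Z; repeat split; [lia| |]; apply (E _ _ _ Hb); simpl; lia.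
- exists i; repeat split; [lia| |]; apply (E _ _ _ Hb); simpl; lia.
- destruct Hi.
  + exists i; repeat split; [lia| |]; apply (E _ _ _ Hb1); simpl; lia.
  + exists (i - 1)%Z; repeat split; [lia| |]; apply (E _ _ _ Hb2); simpl; lia.
Qed.

Lemma absD2_away (f : R -> R) (z J M x0 h : R) (k j : Z) :
  0 < h -> taylor_bound (fun t => f t - kink z J t) M ->
  grid x0 h (k - 1) <= z <= grid x0 h k -> (j < k - 1 \/ k < j)%Z ->
  absD2 f x0 h j <= 2 * (M * h ^ 2).
Proof.
intros Hh Hf Hz Hj; apply (Delta2_away f z J); [lra|easy|].
destruct Hj as [Hj | Hj].
- assert (H := grid_le x0 h (j + 1) (k - 1) Hh ltac:(lia)).
  rewrite grid_add in H; lra.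
- assert (H := grid_le x0 h k (j - 1) Hh ltac:(lia)).
  rewrite grid_sub in H; lra.
Qed.

Lemma absD2_kink_nodes (f : R -> R) (z J M x0 h : R) (k : Z) :
  0 < h -> taylor_bound (fun t => f t - kink z J t) M ->
  grid x0 h (k - 1) <= z <= grid x0 h k ->
  Rabs J * (grid x0 h k - z) - 2 * (M * h ^ 2) <= absD2 f x0 h (k - 1) /\
  Rabs J * (z - grid x0 h (k - 1)) - 2 * (M * h ^ 2) <= absD2 f x0 h k.
Proof.
intros Hh Hf Hz; unfold absD2; rewrite grid_sub in *; split.
- assert (H := Delta2_near f z J M h (grid x0 h k - 1 * h) Hh Hf ltac:(lra)).
  rewrite (Rabs_left1 (grid x0 h k - 1 * h - z)) in H by lra.
  replace (h - - (grid x0 h k - 1 * h - z)) with (grid x0 h k - z) in H by ring.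
  exact H.
- assert (H := Delta2_near f z J M h (grid x0 h k) Hh Hf ltac:(lra)).
  rewrite (Rabs_pos_eq (grid x0 h k - z)) in H by lra.
  replace (h - (grid x0 h k - z)) with (z - (grid x0 h k - 1 * h)) in H by ring.
  exact H.
Qed.

(** The kink contributions at the two ends of I_k sum to |J| h, so the two second differences there
    sum to at least |J| h - 4 M h^2. A bad label would put both below the noise level 2 M h^2, which
    forces |J| h < 8 M h^2. *)
Lemma not_bad_two_away (f : R -> R) (z J M x0 h : R) (i k : Z) :
  0 < h -> taylor_bound (fun t => f t - kink z J t) M ->
  grid x0 h (k - 1) <= z <= grid x0 h k ->
  8 * (M * h ^ 2) < Rabs J * h ->
  (i = k - 2 \/ i = k + 2)%Z -> ~ bad f x0 h i.
Proof.
intros Hh Hf Hz HJ Hi Hb.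
destruct (bad_dominated f x0 h i k Hi Hb) as [j [Hj [H1 H2]]].
assert (H3 := absD2_away f z J M x0 h k j Hh Hf Hz Hj).
destruct (absD2_kink_nodes f z J M x0 h k Hh Hf Hz) as [H4 H5].
rewrite grid_sub in H5; lra.
Qed.

(** If the left side exceeded 4 M h^2, both ends of I_k would have second differences above 2 M h^2,
    the bound at all other nodes, and I_k would be bad. *)
Lemma good_kink_cell (f : R -> R) (z J M x0 h : R) (k : Z) :
  0 < h -> 0 <= M -> taylor_bound (fun t => f t - kink z J t) M ->
  grid x0 h (k - 1) <= z <= grid x0 h k ->
  ~ bad f x0 h k ->
  Rabs J * Rmin (z - grid x0 h (k - 1)) (grid x0 h k - z) <= 4 * (M * h ^ 2).
Proof.
intros Hh HM Hf Hz Hb; apply Rnot_lt_le; intros Hlt; apply Hb.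
destruct (absD2_kink_nodes f z J M x0 h k Hh Hf Hz) as [H4 H5].
assert (HJ := Rabs_pos J).
assert (Rabs J * Rmin (z - grid x0 h (k - 1)) (grid x0 h k - z)
        <= Rabs J * (z - grid x0 h (k - 1)))
  by (apply Rmult_le_compat_l; [easy | apply Rmin_l]).
assert (Rabs J * Rmin (z - grid x0 h (k - 1)) (grid x0 h k - z)
        <= Rabs J * (grid x0 h k - z))
  by (apply Rmult_le_compat_l; [easy | apply Rmin_r]).
(* The third rule applies because each end of I_k is compared only with nodes on its outer side, so
   the two large values never compete. *)
right; right; split; apply dominates_of_lt; try easy; intros n Hn;
  eapply Rle_lt_trans;
  try (apply (absD2_away f z J M x0 h k); try easy; simpl in Hn; lia); lra.
Qed.

(** * The local interpolant and the crossing of two affine functions *)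

Lemma enosr_local_good (f : R -> R) (x0 h : R) (i : Z) (x : R) :
  ~ bad f x0 h i -> enosr_local f x0 h i x = affine_interp f x0 h i x.
Proof.
intros H; unfold enosr_local; destruct excluded_middle_informative; easy.
Qed.

Lemma enosr_local_cases (f : R -> R) (x0 h : R) (i : Z) (x : R) :
  exists j, (j = i \/ j = i - 2 \/ j = i + 2)%Z /\
    enosr_local f x0 h i x = affine_interp f x0 h j x.
Proof.
unfold enosr_local.
destruct excluded_middle_informative; [|exists i; auto].
destruct excluded_middle_informative; [|exists i; auto].
destruct Rlt_dec; [exists (i - 2)%Z | exists (i + 2)%Z]; auto.
Qed.

Lemma enosr_local_crossing (f : R -> R) (x0 h : R) (i : Z) (x : R) :
  bad f x0 h i ->
  (exists! y, affine_interp f x0 h (i - 2) y = affine_interp f x0 h (i + 2) y) ->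
  exists y,
    affine_interp f x0 h (i - 2) y = affine_interp f x0 h (i + 2) y /\
    enosr_local f x0 h i x =
      if Rlt_dec x y then affine_interp f x0 h (i - 2) x
      else affine_interp f x0 h (i + 2) x.
Proof.
intros Hb Hu; unfold enosr_local.
destruct excluded_middle_informative; [|easy].
destruct excluded_middle_informative as [H|]; [|easy].
destruct constructive_definite_description as [y Hy]; simpl.
now exists y.
Qed.

Lemma secant_affine (f : R -> R) (a h x y : R) :
  secant f a h x - secant f a h y = (f (a + h) - f a) / h * (x - y).
Proof. unfold secant; ring. Qed.

(** At two points at distance [h], [v - u] is within [e] of the line of slope [J] through [z]. Its
    increment is thus within [2 * e] of [J * h], so its slope is nonzero with the sign of [J]. *)
Lemma affine_crossing (u v : R -> R) (su sv J z a h e : R) :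
  (forall x y, u x - u y = su * (x - y)) ->
  (forall x y, v x - v y = sv * (x - y)) ->
  0 < h ->
  Rabs (v a - u a - J * (a - z)) <= e ->
  Rabs (v (a + h) - u (a + h) - J * (a + h - z)) <= e ->
  2 * e < Rabs J * h ->
  0 < J * (sv - su) /\ exists! y, u y = v y.
Proof.
intros Hu Hv Hh H1 H2 HJ.
assert (Hu1 := Hu (a + h) a); assert (Hv1 := Hv (a + h) a).
replace (a + h - a) with h in * by ring.
apply Rabs_le_between in H1, H2.
assert (Hs : 0 < J * (sv - su)).
{ assert (Hd : Rabs ((sv - su) * h - J * h) < Rabs J * h)
    by (apply Rabs_lt_between; lra).
  apply Rabs_lt_between in Hd; revert Hd; unfold Rabs; destruct Rcase_abs;
    intros Hd; nra. }
split; [exact Hs|].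
assert (Hne : sv - su <> 0) by (intros E; rewrite E in Hs; lra).
assert (Hy : forall y, u y = v y <-> y = a - (v a - u a) / (sv - su)).
{ intros y; assert (Hu2 := Hu y a); assert (Hv2 := Hv y a); split; intros Hy.
  - replace (v a - u a) with (- (y - a) * (sv - su)) by lra; field; lra.
  - assert (E : (sv - su) * (y - a) = - (v a - u a)) by (rewrite Hy; field; lra).
    lra. }
exists (a - (v a - u a) / (sv - su)); split.
- now apply Hy.
- intros y' Hy'; symmetry; now apply Hy.
Qed.

(** Here [L] is the smooth part at [x]. If the wrong branch is taken, [x] lies between [y] and [z],
    where [v x - u x] and [J * (x - z)] do not have the same strict sign. They differ by at most
    [2 * e], so |J (x - z)| is at most [2 * e]; the branch itself adds [e]. *)
Lemma crossing_error (u v : R -> R) (su sv J z x y L e : R) :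
  (forall x y, u x - u y = su * (x - y)) ->
  (forall x y, v x - v y = sv * (x - y)) ->
  0 < J * (sv - su) -> u y = v y ->
  Rabs (u x - L) <= e -> Rabs (v x - (L + J * (x - z))) <= e ->
  Rabs (L + kink z J x - if Rlt_dec x y then u x else v x) <= 3 * e.
Proof.
intros Hu Hv Hs Hy H1 H2.
assert (Hu1 := Hu x y); assert (Hv1 := Hv x y).
apply Rabs_le_between in H1, H2.
assert (Hd : v x - u x = (sv - su) * (x - y)) by lra.
destruct (Rlt_dec x y), (Rle_dec x z).
- rewrite kink_left by lra; apply Rabs_le_of; lra.
- rewrite kink_right by lra.
  destruct (Rle_dec 0 J);
    [assert (0 < sv - su) by nra | assert (sv - su < 0) by nra];
    apply Rabs_le_of; nra.
- rewrite kink_left by lra.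
  destruct (Rle_dec 0 J);
    [assert (0 < sv - su) by nra | assert (sv - su < 0) by nra];
    apply Rabs_le_of; nra.
- rewrite kink_right by lra; apply Rabs_le_of; lra.
Qed.

(** * The error on one cell *)

Lemma enosr_local_error (f : R -> R) (z J M x0 h x : R) (i : Z) :
  0 < h -> 0 <= M -> taylor_bound (fun t => f t - kink z J t) M ->
  grid x0 h (i - 1) <= x <= grid x0 h i ->
  Rabs (f x - enosr_local f x0 h i x) <= 300 * (M * h ^ 2).
Proof.
intros Hh HM Hf Hx.
assert (HE : 0 <= M * h ^ 2) by (apply Rmult_le_pos; nra).
set (E := M * h ^ 2) in *.
assert (Hw : forall j, (j = i \/ j = i - 2 \/ j = i + 2)%Z ->
    Rabs (x - (grid x0 h j - h)) <= 3 * h).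
{ intros j Hj; rewrite grid_sub in Hx; apply Rabs_le_of;
    destruct Hj as [-> | [-> | ->]]; rewrite ?grid_sub, ?grid_add; lra. }
(* The threshold is twice the [24 * E] with which [affine_crossing] is used below. In the small-jump
   case it costs 6 * 48 + 12 = 300 times [E], which fixes the final constant. *)
destruct (Rle_dec (Rabs J * h) (48 * E)) as [HJ | HJ].
{ destruct (enosr_local_cases f x0 h i x) as [j [Hj ->]].
  rewrite affine_interp_secant, Rabs_minus_sym.
  assert (H := secant_coarse f z J M _ h x Hh HM Hf (Hw j Hj)).
  fold E in H; lra. }
apply Rnot_le_lt in HJ.
destruct (grid_cell x0 h z Hh) as [k Hk].
assert (Hk' : grid x0 h (k - 1) <= z <= grid x0 h k) by lra.
assert (Hleft : forall j, (j < k)%Z -> grid x0 h j <= z).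
{ intros j Hj; apply Rle_trans with (grid x0 h (k - 1)); [|lra].
  apply grid_le; [lra|lia]. }
assert (Hright : forall j, (k < j)%Z -> z <= grid x0 h j - h).
{ intros j Hj; apply Rle_trans with (grid x0 h k); [lra|].
  assert (H := grid_le x0 h k (j - 1) Hh ltac:(lia)).
  rewrite grid_sub in H; lra. }
(* The secant is accurate when [x] and the whole interval I_j lie on the same side of [z]. *)
assert (Hside : forall j, (j = i \/ j = i - 2 \/ j = i + 2)%Z ->
    ((i < k /\ j < k) \/ (k < i /\ k < j))%Z ->
    Rabs (f x - affine_interp f x0 h j x) <= 12 * E).
{ intros j Hj Hij.
  rewrite affine_interp_secant, Rabs_minus_sym.
  destruct Hij as [[Hi Hjk] | [Hi Hjk]].
  - assert (H := secant_left f z J M (grid x0 h j - h) h x Hh HM Hf).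
    rewrite kink_left, Rminus_0_r in H by (specialize (Hleft i Hi); lra).
    apply H; [specialize (Hleft j Hjk); lra | auto].
  - assert (H := secant_right f z J M (grid x0 h j - h) h x Hh HM Hf).
    rewrite kink_right in H
      by (specialize (Hright i Hi); rewrite grid_sub in Hx; lra).
    replace (f x - J * (x - z) + J * (x - z)) with (f x) in H by ring.
    apply H; auto. }
assert (Hgood : ~ bad f x0 h i ->
    Rabs (f x - enosr_local f x0 h i x) <= 300 * E).
{ intros Hb; rewrite enosr_local_good by exact Hb.
  destruct (Z.eq_dec i k) as [-> | Hik].
  - rewrite affine_interp_secant, Rabs_minus_sym.
    assert (H1 := good_kink_cell f z J M x0 h k Hh HM Hf Hk' Hb).
    rewrite grid_sub in H1, Hk', Hx.
    replace (grid x0 h k - 1 * h) with (grid x0 h k - h) in * by ring.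
    assert (H2 := secant_fine f z J M (grid x0 h k - h) h x Hh HM Hf).
    replace (grid x0 h k - h + h) with (grid x0 h k) in H2 by ring.
    specialize (H2 Hk' Hx); fold E in H1, H2; lra.
  - specialize (Hside i ltac:(auto) ltac:(lia)); lra. }
destruct (excluded_middle_informative (bad f x0 h i)) as [Hb | Hb];
  [|now apply Hgood].
(* At distance more than 2 every candidate interval stays on the side of I_i. At distance exactly 2
   a candidate could be I_k itself, but then I_i is not bad. *)
destruct (Z_lt_le_dec 2 (Z.abs (i - k))) as [Hfar | Hnear].
{ destruct (enosr_local_cases f x0 h i x) as [j [Hj ->]].
  specialize (Hside j Hj ltac:(lia)); lra. }
destruct (Z.eq_dec 2 (Z.abs (i - k))) as [Htwo | Hone].
{ exfalso; revert Hb; apply (not_bad_two_away f z J M x0 h i k); auto.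
  - fold E; lra.
  - lia. }
(* Now [i] differs from [k] by at most 1, so I_(i-2) lies to the left of [z] and I_(i+2) to the
   right: each secant follows one smooth branch. *)
set (u := affine_interp f x0 h (i - 2)).
set (v := affine_interp f x0 h (i + 2)).
assert (Hu : forall t, Rabs (t - (grid x0 h (i - 2) - h)) <= 3 * h ->
    Rabs (u t - (f t - kink z J t)) <= 12 * E).
{ intros t Ht; unfold u; rewrite affine_interp_secant.
  apply (secant_left f z J M); auto.
  specialize (Hleft (i - 2)%Z ltac:(lia)); lra. }
assert (Hv : forall t, Rabs (t - (grid x0 h (i + 2) - h)) <= 3 * h ->
    Rabs (v t - (f t - kink z J t + J * (t - z))) <= 12 * E).
{ intros t Ht; unfold v; rewrite affine_interp_secant.
  apply (secant_right f z J M); auto.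
  apply Hright; lia. }
assert (Hd : forall t, grid x0 h i - h <= t <= grid x0 h i ->
    Rabs (v t - u t - J * (t - z)) <= 24 * E).
{ intros t Ht.
  assert (H1 : Rabs (u t - (f t - kink z J t)) <= 12 * E)
    by (apply Hu; rewrite grid_sub; apply Rabs_le_of; lra).
  assert (H2 : Rabs (v t - (f t - kink z J t + J * (t - z))) <= 12 * E)
    by (apply Hv; rewrite grid_add; apply Rabs_le_of; lra).
  apply Rabs_le_between in H1, H2; apply Rabs_le_of; lra. }
(* The slope is left open and found by unification with [secant_affine]. *)
eassert (Hua : forall s t, u s - u t = _ * (s - t))
  by (intros s t; unfold u; rewrite !affine_interp_secant; apply secant_affine).
eassert (Hva : forall s t, v s - v t = _ * (s - t))
  by (intros s t; unfold v; rewrite !affine_interp_secant; apply secant_affine).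
destruct (affine_crossing u v _ _ J z (grid x0 h i - h) h (24 * E) Hua Hva Hh)
  as [Hs Hex].
- apply Hd; lra.
- apply Hd; lra.
- lra.
- destruct (enosr_local_crossing f x0 h i x Hb Hex) as [y [Hy ->]].
  fold u v in Hy |- *.
  assert (H := crossing_error u v _ _ J z x y (f x - kink z J x) (12 * E)
    Hua Hva Hs Hy (Hu x (Hw (i - 2)%Z ltac:(auto))) (Hv x (Hw (i + 2)%Z ltac:(auto)))).
  replace (f x - kink z J x + kink z J x) with (f x) in H by ring; lra.
Qed.

(** * Suprema as extended reals and the conclusion *)

Lemma sup_abs_bounded (A : R -> Prop) (g : R -> R) (a B : R) :
  A a -> (forall x, A x -> Rabs (g x) <= B) ->
  exists M : R, sup_abs A g = Finite M /\ 0 <= M /\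
    forall x, A x -> Rabs (g x) <= M.
Proof.
intros Ha HB; unfold sup_abs.
set (S := fun y => exists x, A x /\ y = Rabs (g x)).
destruct (Lub_Rbar_correct S) as [Hub Hle].
assert (Hup : Rbar_le (Lub_Rbar S) B).
{ apply Hle; intros y [x [Hx ->]]; now apply HB. }
assert (Hlow : forall x, A x -> Rbar_le (Rabs (g x)) (Lub_Rbar S)).
{ intros x Hx; apply Hub; now exists x. }
assert (Ha' := Hlow a Ha).
destruct (Lub_Rbar S) as [M| |]; try easy.
exists M; repeat split; [|exact Hlow].
apply Rle_trans with (Rabs (g a)); [apply Rabs_pos | exact Ha'].
Qed.

Lemma sup_norm_le (g : R -> R) (B : R) :
  (forall x, Rabs (g x) <= B) -> Rbar_le (sup_norm g) B.
Proof.
intros H; apply (proj2 (Lub_Rbar_correct _)); intros y [x [_ ->]]; apply H.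
Qed.

Theorem theorem3p3 :
  exists C : R, 0 < C /\
  forall (f : R -> R) (z : R),
    (forall x : R, continuous f x) ->
    bounded_second_derivative_off f z ->
    derivative_jump f z ->
    forall x0 h : R, 0 < h ->
    Rbar_le
      (sup_norm (fun x => f x - enosr f x0 h x))
      (Rbar_mult (Finite (C * h ^ 2))
                 (sup_abs (fun x => x <> z) (Derive_n f 2))).
Proof.
exists 300; split; [lra|].
intros f z Hc [Hd [B HB]] [l [r [Hl [Hr _]]]] x0 h Hh.
(* The point [z + 1] shows that the supremum is over a nonempty set, hence finite and nonnegative;
   [Rbar_mult] then reduces to a real product. *)
destruct (sup_abs_bounded (fun x => x <> z) (Derive_n f 2) (z + 1) B)
  as [M [-> [HM0 HM]]]; [lra|exact HB|].
apply sup_norm_le; intros x.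
assert (Hf : taylor_bound (fun t => f t - kink z (r - l) t) M).
{ apply taylor_bound_minus_kink; auto.
  - intros t Ht; now apply Hd.
  - intros t Ht; split; [now apply Hd | now apply HM]. }
destruct (grid_cell x0 h x Hh) as [i Hi].
rewrite (enosr_spec f x0 h Hh i x Hi).
replace (300 * h ^ 2 * M) with (300 * (M * h ^ 2)) by ring.
apply (enosr_local_error f z (r - l) M); auto; lra.
Qed.
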